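(* Let $G$ be a completable graph and $\Sigma(G)$ a real $G$-partial positive definite matrix. Let $f_0,f_1$ be zero-mean multivariate Gaussian densities on $\mathbb{R}^n$ with covariance matrices $\Sigma_0,\Sigma_1\in\mathfrak{p}^+[\Sigma(G)]$ respectively. Then: (1) $H(f_1)-H(f_0)=\frac12\int_0^1\operatorname{tr}\big(\Sigma(\lambda)^{-1}(\Sigma_1-\Sigma_0)\big)\,d\lambda$, where $\Sigma(\lambda)=(1-\lambda)\Sigma_0+\lambda\Sigma_1$; (2) for $t\in[0,1]$, if $f_0\#_tf_1$ denotes the zero-mean multivariate Gaussian density on $\mathbb{R}^n$ with covariance matrix $\Sigma_0\#_t\Sigma_1$, then $H(f_0\#_tf_1)=(1-t)H(f_0)+tH(f_1)$.
   Context: A graph $G=(V,E)$ is a finite undirected graph on $V=\{1,\dots,n\}$ containing all loops. A $G$-partial matrix has entries specified exactly for $\{i,j\}\in E$; a completion agrees with it on $E$. It is partial positive definite if it is symmetric on $E$ and every principal submatrix indexed by a clique of $G$ is positive definite. $G$ is completable if every $G$-partial positive semidefinite matrix has a positive semidefinite completion (equivalently $G$ chordal). $\mathfrak{p}^+[\Sigma(G)]$ is the set of positive definite completions. The zero-mean Gaussian density with covariance $\Sigma$ is $f(x)=(2\pi)^{-n/2}(\det\Sigma)^{-1/2}\exp\{-\frac12x^\top\Sigma^{-1}x\}$, and its Shannon entropy is $H(f)=-\int_{\mathbb{R}^n}f(x)\log f(x)\,dx$. For positive definite $A,B$, $A\#_tB:=A^{1/2}(A^{-1/2}BA^{-1/2})^tA^{1/2}$.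 *)

(* Defs.v *)
From HB Require Import structures.
From mathcomp Require Import all_boot all_order all_algebra.
From mathcomp Require Import all_classical all_reals all_analysis.
Set Implicit Arguments. Unset Strict Implicit. Unset Printing Implicit Defensive.
Import Order.TTheory GRing.Theory Num.Theory.
Import numFieldNormedType.Exports.
Local Open Scope classical_set_scope.
Local Open Scope ring_scope.

Section Defs.
Variable R : realType.

Definition psd m (A : 'M[R]_m) : Prop :=
  A^T = A /\ forall x : 'cV[R]_m, 0 <= (x^T *m A *m x) 0 0.

Definition posdef m (A : 'M[R]_m) : Prop :=
  A^T = A /\ forall x : 'cV[R]_m, x != 0 -> 0 < (x^T *m A *m x) 0 0.

(* A graph is an edge relation E : rel 'I_n which is assumed reflexive
   (contains all loops) and symmetric (undirected). *)

Definition is_clique n (E : rel 'I_n) (S : {set 'I_n}) : Prop :=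
  forall i j, i \in S -> j \in S -> E i j.

Definition principal_submx n (A : 'M[R]_n) (S : {set 'I_n}) : 'M[R]_#|S| :=
  \matrix_(i < #|S|, j < #|S|) A (enum_val i) (enum_val j).

(* A G-partial matrix is represented by a full n x n matrix of which only the
   entries (i,j) with E i j are regarded as specified. *)
Definition sym_on n (E : rel 'I_n) (A : 'M[R]_n) : Prop :=
  forall i j, E i j -> A i j = A j i.

Definition partial_psd n (E : rel 'I_n) (A : 'M[R]_n) : Prop :=
  sym_on E A /\
  forall S : {set 'I_n}, is_clique E S -> psd (principal_submx A S).

Definition partial_posdef n (E : rel 'I_n) (A : 'M[R]_n) : Prop :=
  sym_on E A /\
  forall S : {set 'I_n}, is_clique E S -> posdef (principal_submx A S).

Definition is_completion n (E : rel 'I_n) (A B : 'M[R]_n) : Prop :=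
  forall i j, E i j -> B i j = A i j.

Definition completable n (E : rel 'I_n) : Prop :=
  forall A : 'M[R]_n, partial_psd E A ->
    exists B : 'M[R]_n, is_completion E A B /\ psd B.

Definition pd_completions n (E : rel 'I_n) (A : 'M[R]_n) : set 'M[R]_n :=
  [set B | is_completion E A B /\ posdef B].

Definition orthogonal_mx n (U : 'M[R]_n) : Prop := U^T *m U = 1%:M.

(* A ^ t for A positive definite, via the spectral decomposition
   A = U diag(d) U^T (U orthogonal, d > 0):  A ^ t = U diag(d^t) U^T.
   (Chosen by classical choice; the value is independent of the choice.) *)
Definition mxpowR n (A : 'M[R]_n) (t : R) : 'M[R]_n :=
  xget 0 [set P | exists (U : 'M[R]_n) (d : 'rV[R]_n),
     [/\ orthogonal_mx U, (forall i, 0 < d 0 i),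
         A = U *m diag_mx d *m U^T &
         P = U *m diag_mx (map_mx (fun a => powR a t) d) *m U^T]].

Definition mxgeo n (A B : 'M[R]_n) (t : R) : 'M[R]_n :=
  let Ah := mxpowR A (2^-1) in
  let Amh := mxpowR A (- 2^-1) in
  Ah *m mxpowR (Amh *m B *m Amh) t *m Ah.

Definition gauss_density n (Sigma : 'M[R]_n) (x : 'cV[R]_n) : R :=
  powR (2 * pi) (- (n%:R / 2)) * powR (\det Sigma) (- 2^-1) *
  expR (- 2^-1 * (x^T *m invmx Sigma *m x) 0 0).

(* Integral over R^n w.r.t. n-dimensional Lebesgue measure, written as the
   iterated integral over the coordinates (Fubini). *)
Fixpoint intRn (n : nat) : ('cV[R]_n -> \bar R) -> \bar R :=
  match n return ('cV[R]_n -> \bar R) -> \bar R with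
  | 0 => fun f => f 0
  | n'.+1 => fun f =>
      (\int[@lebesgue_measure R]_(x in [set: R])
         intRn (fun y : 'cV[R]_n' => f (col_mx (x%:M : 'M[R]_1) y)))%E
  end.

Definition entropy n (f : 'cV[R]_n -> R) : \bar R :=
  (- intRn (fun x => (f x * ln (f x))%:E))%E.

End Defs.

(* Main.v *)
(** The entropy of the centred Gaussian with covariance [S] is
    [n/2 * (1 + ln (2 pi)) + 1/2 * ln (det S)], so both claims are statements
    about [ln (det _)].  The iterated integral is computed by induction on [n]:
    splitting off one coordinate of the quadratic form by a Schur complement
    leaves a shifted Gaussian in the other coordinates, and the integrand
    [(a + b q) exp (- q / 2)] keeps its shape.

    For (1), a congruence [T] diagonalises both matrices, [S0 = T T^T] and
    [S1 = T diag(d) T^T]; the trace becomes the derivative of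
    [sum_i ln (1 + l (d_i - 1))], whose increment on [0, 1] is
    [ln (det S1) - ln (det S0)].  For (2), any spectral decomposition gives
    [det (A ^ t) = (det A) ^ t], hence
    [ln (det (S0 #_t S1)) = (1 - t) ln (det S0) + t ln (det S1)]. *)

Require Import Defs.
From HB Require Import structures.
From mathcomp Require Import all_boot all_order all_algebra.
From mathcomp Require Import all_classical all_reals all_analysis.
From mathcomp Require Import measurable_realfun complex ring lra.
Import Order.TTheory GRing.Theory Num.Theory.
Import numFieldNormedType.Exports.
Local Open Scope classical_set_scope.
Local Open Scope ring_scope.

Set Implicit Arguments. Unset Strict Implicit. Unset Printing Implicit Defensive.

(** * Spectral theorem for real symmetric matrices *)

(* The eigenvalue is found over [R[i]], where hermitian matrices have real spectrum. *)
Lemma symmetric_eigenvalue (R : rcfType) n (A : 'M[R]_n.+1) :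
  A^T = A -> exists a, eigenvalue A a.
Proof.
move=> As.
pose toC := real_complex R : {rmorphism R -> R[i]}.
pose C := map_mx toC A.
have Ch : C \is hermsymmx.
  apply: realsym_hermsym.
    by apply/is_hermitianmxP; rewrite expr0 scale1r map_mx_id// map_trmx As.
  by apply/mxOverP => i j; rewrite mxE; apply/complex_realP; exists (A i j).
have /mxOverP/(_ 0 0) := hermitian_spectral_diag_real Ch.
have /hermitian_normalmx/orthomx_spectralP := Ch.
have uP := spectral_unit C.
set P := spectralmx C in uP *; set d := spectral_diag C => eC.
move=> /complex_realP[a ea].
(* The characteristic polynomial of [C] is the image of that of [A], so the root [toC a] of the
   former descends to the root [a] of the latter. Row 0 of the unitary [P] is an eigenvector of [C]
   for it. *)
exists a; rewrite eigenvalue_root_char -(fmorph_root toC) map_char_poly.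
rewrite -eigenvalue_root_char -/C eC; apply/eigenvalueP.
exists (row 0 P); last first.
  apply/eqP => /(congr1 (mulmx^~ (invmx P))).
  rewrite -row_mul mulmxV// mul0mx => /rowP/(_ 0).
  by rewrite !mxE eqxx => /eqP; rewrite oner_eq0.
rewrite -row_mul !mulmxA mulmxV// mul1mx row_mul row_diag_mx.
by rewrite -scalemxAl -rowE ea.
Qed.

Lemma cV_dot_ge0 (R : realDomainType) n (x : 'cV[R]_n) : 0 <= (x^T *m x) 0 0.
Proof. by rewrite mxE sumr_ge0// => i _; rewrite mxE -expr2 sqr_ge0. Qed.

Lemma cV_dot_eq0 (R : realDomainType) n (x : 'cV[R]_n) :
  ((x^T *m x) 0 0 == 0) = (x == 0).
Proof.
apply/eqP/eqP => [|->]; last by rewrite mulmx0 mxE.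
rewrite mxE => /psumr_eq0P h; apply/colP => i; rewrite mxE; apply/eqP.
have {h} : x^T 0 i * x i 0 = 0.
  by apply: h => // j _; rewrite mxE -expr2 sqr_ge0.
by rewrite mxE -expr2 => /eqP; rewrite sqrf_eq0.
Qed.

(** Reflection along [w = u - e], which exchanges the two unit vectors. It serves to move the first
    basis vector onto an eigenvector. *)
Lemma householder (R : realFieldType) n (e u : 'cV[R]_n) :
  e^T *m e = 1%:M -> u^T *m u = 1%:M ->
  exists H : 'M[R]_n, [/\ H^T = H, H *m H = 1%:M & H *m e = u].
Proof.
move=> ee uu; have [->|] := eqVneq u e.
  by exists 1%:M; rewrite trmx1 !mul1mx.
rewrite -subr_eq0; set w := u - e => w0.
set c := (w^T *m w) 0 0.
have c0 : c != 0 by rewrite cV_dot_eq0.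
have ww : w^T *m w = c%:M by rewrite [LHS]mx11_scalar.
have ue : e^T *m u = u^T *m e.
  by rewrite [LHS]mx11_scalar [RHS]mx11_scalar -[u in LHS]trmxK -trmx_mul mxE.
(* As [e] and [u] are unit vectors, [w^T w = 2 - 2 u^T e], while [w^T e = u^T e - 1]. Hence the
   reflection sends [e] to [e + w = u]. *)
have we : w^T *m e = (- (c / 2))%:M.
  rewrite [LHS]mx11_scalar; congr _%:M; rewrite /c /w.
  rewrite linearB/= mulmxBl mulmxBr mulmxBl ee uu mulmxBl ee ue !mxE eqxx.
  by field.
exists (1%:M - (2 / c) *: (w *m w^T)); split.
- by rewrite linearB linearZ/= trmx1 trmx_mul trmxK.
- rewrite mulmxBl mul1mx mulmxBr mulmx1 -scalemxAl -scalemxAr scalerA.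
  rewrite -mulmxA (mulmxA w^T) ww mul_scalar_mx -scalemxAr scalerA.
  rewrite (_ : 2 / c * (2 / c) * c = 2 / c + 2 / c); last by field.
  by rewrite scalerDl opprB addrK subrK.
- rewrite mulmxBl mul1mx -scalemxAl -mulmxA we mul_mx_scalar scalerA.
  rewrite (_ : 2 / c * _ = -1); last by field.
  by rewrite scaleN1r opprK addrC subrK.
Qed.

(** Deflation: conjugating by a reflection that sends the first basis vector to a unit eigenvector
    splits off a 1 by 1 block, and the induction hypothesis diagonalises the other block. *)
Theorem symmetric_spectral (R : rcfType) n (A : 'M[R]_n) : A^T = A ->
  exists (U : 'M[R]_n) (d : 'rV[R]_n),
    U^T *m U = 1%:M /\ A = U *m diag_mx d *m U^T.
Proof.
elim: n A => [A _|n IH]; last rewrite -[n.+1]/(1 + n)%N => A As.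
  by exists 1%:M, 0; split; apply/matrixP => -[].
have [a /eigenvalueP[v vA v0]] := @symmetric_eigenvalue R n A As.
have vv0 : 0 < (v *m v^T) 0 0.
  by rewrite -[v in v *m _]trmxK lt_def cV_dot_ge0 cV_dot_eq0 trmx_eq0 v0.
pose r := Num.sqrt ((v *m v^T) 0 0); pose u := r^-1 *: v^T.
have uu : u^T *m u = 1%:M.
  rewrite /u [(_ *: _)^T]linearZ/= trmxK -scalemxAl -scalemxAr scalerA.
  rewrite [v *m _]mx11_scalar scale_scalar_mx -(sqr_sqrtr (ltW vv0)) -/r.
  by congr _%:M; field; rewrite gt_eqF// sqrtr_gt0.
have Au : A *m u = a *: u.
  by rewrite /u -scalemxAr -[A]As -trmx_mul vA linearZ/= scalerA mulrC -scalerA.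
pose e : 'cV[R]_(1 + n) := col_mx 1%:M 0.
have ee : e^T *m e = 1%:M.
  by rewrite /e tr_col_mx mul_row_col trmx1 trmx0 mul1mx mul0mx addr0.
have [H [Hs HH He]] := householder ee uu.
pose B : 'M[R]_(1 + n) := H *m A *m H.
have eA : A = H *m B *m H by rewrite /B !mulmxA HH mul1mx -mulmxA HH mulmx1.
have Bs : B^T = B by rewrite /B !trmx_mul Hs As mulmxA.
have Be : B *m e = a *: e.
  by rewrite /B -!mulmxA He Au -scalemxAr -He mulmxA HH mul1mx.
(* The eigenvector equation fixes the first column of [B]; symmetry then clears the rest of the
   first row. *)
clearbody B; have eB : B = block_mx a%:M 0 0 (drsubmx B).
  rewrite -{1}(submxK B).
  move: Be; rewrite -{1}(submxK B) /e mul_block_col !mulmx1 !mulmx0 !addr0.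
  rewrite scale_col_mx scaler0 scalemx1 => /eq_col_mx[-> h].
  have -> : ursubmx B = 0 by rewrite -[LHS]trmxK trmx_ursub Bs h trmx0.
  by rewrite h.
have [|V [d [VV eV]]] := IH (drsubmx B); first by rewrite trmx_drsub Bs.
exists (H *m block_mx 1%:M 0 0 V), (row_mx a%:M d); split.
  rewrite trmx_mul Hs -mulmxA (mulmxA H) HH mul1mx tr_block_mx mulmx_block.
  by rewrite trmx1 !trmx0 !mulmx0 !mul0mx !mul1mx VV !addr0 !add0r -scalar_mx_block.
rewrite eA trmx_mul Hs !mulmxA; congr (_ *m _); rewrite -!mulmxA; congr (_ *m _).
rewrite eB diag_mx_row tr_block_mx !mulmx_block trmx1 !trmx0.
rewrite !mulmx0 !mul0mx !mul1mx !mulmx1 !addr0 !add0r mulmxA -eV.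
congr block_mx; last by rewrite mulmx0.
by apply/matrixP => i j; rewrite !mxE !ord1 !mulr1n.
Qed.

(** * Positive definite matrices *)

Lemma orthogonal_mx_unit (R : realType) n (U : 'M[R]_n) :
  orthogonal_mx U -> U \in unitmx.
Proof. by move/mulmx1_unit => []. Qed.

Lemma det_orthogonal_conj (R : realType) n (U A : 'M[R]_n) :
  orthogonal_mx U -> \det (U *m A *m U^T) = \det A.
Proof.
move=> UU; rewrite !det_mulmx mulrAC -det_mulmx.
by rewrite (mulmx1C UU) det1 mul1r.
Qed.

Lemma posdef_sym (R : realType) n (A : 'M[R]_n) : posdef A -> A^T = A.
Proof. by case. Qed.

Lemma posdef_congr (R : realType) n (A M : 'M[R]_n) :
  M \in unitmx -> posdef A -> posdef (M^T *m A *m M).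
Proof.
move=> uM [As Ap]; split; first by rewrite !trmx_mul trmxK As mulmxA.
move=> x x0; have := Ap (M *m x); rewrite trmx_mul !mulmxA; apply.
by apply: contraNneq x0 => /(congr1 (mulmx (invmx M))); rewrite mulKmx// mulmx0 => ->.
Qed.

Lemma posdef_diag (R : realType) n (d : 'rV[R]_n) :
  (forall i, 0 < d 0 i) -> posdef (diag_mx d).
Proof.
move=> d0; split=> [|x x0]; first exact: tr_diag_mx.
have -> : (x^T *m diag_mx d *m x) 0 0 = \sum_i d 0 i * x i 0 ^+ 2.
  rewrite mxE; apply: eq_bigr => i _; rewrite mul_mx_diag !mxE; ring.
have [i xi] : exists i, x i 0 != 0.
  apply/existsP; apply: contra_neqT x0 => /existsPn h.
  by apply/colP => i; rewrite mxE; apply/eqP; have := h i; rewrite negbK.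
rewrite (bigD1 i)//= ltr_pwDl//.
  by rewrite mulr_gt0// exprn_even_gt0.
by apply: sumr_ge0 => j _; rewrite mulr_ge0 ?sqr_ge0// ltW.
Qed.

Lemma posdef_orthogonal_diag (R : realType) n (U : 'M[R]_n) (d : 'rV[R]_n) :
  orthogonal_mx U -> (forall i, 0 < d 0 i) -> posdef (U *m diag_mx d *m U^T).
Proof.
move=> /orthogonal_mx_unit uU d0; rewrite -{1}[U]trmxK.
by apply: posdef_congr (posdef_diag d0); rewrite unitmx_tr.
Qed.

Lemma posdef_spectral (R : realType) n (A : 'M[R]_n) : posdef A ->
  exists (U : 'M[R]_n) (d : 'rV[R]_n), [/\ orthogonal_mx U,
    forall i, 0 < d 0 i & A = U *m diag_mx d *m U^T].
Proof.
move=> [As Ap]; have [U [d [UU eA]]] := symmetric_spectral As.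
exists U, d; split => // i.
have eD : U^T *m A *m U = diag_mx d.
  by rewrite eA !mulmxA UU mul1mx -mulmxA UU mulmx1.
(* The quadratic form of [A] at column [i] of [U] equals [d 0 i]. *)
have Ui0 : U *m delta_mx i 0 != 0 :> 'cV_n.
  apply/eqP => /(congr1 (mulmx U^T)); rewrite mulmxA UU mul1mx mulmx0.
  by move=> /matrixP/(_ i 0)/eqP; rewrite !mxE !eqxx oner_eq0.
have := Ap _ Ui0; rewrite trmx_mul !mulmxA -(mulmxA _ _ A) -(mulmxA _ _ U) eD.
by rewrite trmx_delta -rowE -colE !mxE eqxx mulr1n.
Qed.

Lemma posdef_det_gt0 (R : realType) n (A : 'M[R]_n) : posdef A -> 0 < \det A.
Proof.
move=> /posdef_spectral[U [d [UU d0 ->]]].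
by rewrite det_orthogonal_conj// det_diag; apply: prodr_gt0.
Qed.

Lemma posdef_unit (R : realType) n (A : 'M[R]_n) : posdef A -> A \in unitmx.
Proof. by move=> /posdef_det_gt0 h; rewrite unitmxE unitfE gt_eqF. Qed.

(** The inverse is the congruence of [A] by [invmx A] itself. *)
Lemma posdef_inv (R : realType) n (A : 'M[R]_n) : posdef A -> posdef (invmx A).
Proof.
move=> Ap; have uA := posdef_unit Ap.
rewrite -[invmx A]mulmx1 -[1%:M](mulmxV uA) mulmxA.
rewrite -{1}(posdef_sym Ap) -trmx_inv.
by apply: posdef_congr => //; rewrite unitmx_inv.
Qed.

Lemma posdef_block_dr (R : realType) m n (A : 'M[R]_(m + n)) :
  posdef A -> posdef (drsubmx A).
Proof.
move=> [As Ap]; split=> [|x x0]; first by rewrite trmx_drsub As.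
have := Ap (col_mx 0 x); rewrite -{1}(submxK A) tr_col_mx mul_row_block.
rewrite mul_row_col trmx0 !mul0mx mulmx0 !add0r; apply.
by rewrite col_mx_eq0 negb_and x0 orbT.
Qed.

Lemma posdef_block_ul (R : realType) m n (A : 'M[R]_(m + n)) :
  posdef A -> posdef (ulsubmx A).
Proof.
move=> [As Ap]; split=> [|x x0]; first by rewrite trmx_ulsub As.
have := Ap (col_mx x 0); rewrite -{1}(submxK A) tr_col_mx mul_row_block.
rewrite mul_row_col trmx0 !mul0mx mulmx0 !addr0; apply.
by rewrite col_mx_eq0 negb_and x0.
Qed.

(* Block LDL^T factorisation; [s] is the Schur complement of the last block. *)
Lemma posdef_schur (R : realType) n (P : 'M[R]_(1 + n)) : posdef P ->
  exists (s : R) (w : 'cV[R]_n), let L := block_mx 1%:M 0 w 1%:M in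
    [/\ 0 < s, posdef (drsubmx P), \det P = s * \det (drsubmx P) &
        P = L^T *m block_mx s%:M 0 0 (drsubmx P) *m L].
Proof.
move=> Pp; have Qp := posdef_block_dr Pp; have uQ := posdef_unit Qp.
set Q := drsubmx P in Qp uQ *.
(* Completing the square: on a vector [(x, y)] the form becomes [s x^2] plus the [Q]-form of
   [y + x w], and matching the cross terms forces [Q w = dlsubmx P]. *)
pose w := invmx Q *m dlsubmx P; pose s := (ulsubmx P - w^T *m Q *m w) 0 0.
pose L : 'M[R]_(1 + n) := block_mx 1%:M 0 w 1%:M.
have dL : \det L = 1 by rewrite det_lblock !det1 mulr1.
have uL : L \in unitmx by rewrite unitmxE dL unitr1.
pose D : 'M[R]_(1 + n) := block_mx s%:M 0 0 Q.
have eP : P = L^T *m D *m L.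
  rewrite tr_block_mx !trmx1 trmx0 !mulmx_block.
  rewrite !mul1mx !mulmx1 !mulmx0 !mul0mx !addr0 !add0r.
  have Qw : Q *m w = dlsubmx P by rewrite mulKVmx.
  have wQ : w^T *m Q = ursubmx P.
    by rewrite -[LHS]trmxK trmx_mul trmxK (posdef_sym Qp) Qw trmx_dlsub (posdef_sym Pp).
  by rewrite -[s%:M]mx11_scalar subrK Qw wQ submxK.
exists s, w; split=> //.
  (* [D] is congruent to [P], and [s] is its upper left entry. *)
  have : posdef D.
    have -> : D = (invmx L)^T *m P *m invmx L.
      by rewrite eP !mulmxA trmx_inv mulVmx ?unitmx_tr// mul1mx mulmxK.
    by apply: posdef_congr => //; rewrite unitmx_inv.
  move=> /posdef_block_ul; rewrite block_mxKul => -[_ /(_ 1%:M)].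
  rewrite trmx1 mul1mx mulmx1 mxE eqxx mulr1n; apply.
  by apply/eqP => /matrixP/(_ 0 0)/eqP; rewrite !mxE oner_eq0.
by rewrite [in LHS]eP !det_mulmx det_tr dL mul1r mulr1 det_lblock det_scalar1.
Qed.

(** * Gaussian integrals *)

(** The boundary term of the integration by parts below. For [x >= 0], [x <= exp x] and
    [x - x^2 <= 1 - x] bound the product by [e * exp (- x)]. *)
Lemma cvg_id_gauss (R : realType) :
  x * gauss_fun x @[x --> +oo%R] --> (0 : R).
Proof.
have h0 : expR 1 * expR (- x) @[x --> +oo%R] --> (0 : R).
  by rewrite -(mulr0 (expR 1)); apply: cvgM; [exact: cvg_cst|exact: cvgr_expR].
apply: (@squeeze_cvgr _ _ _ _ (cst 0) (fun x => expR 1 * expR (- x))) => //;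
  last exact: cvg_cst.
near=> x.
have x0 : 0 <= x by near: x; apply: nbhs_pinfty_ge; exact: num_real.
rewrite mulr_ge0 ?gauss_fun_ge0//= -expRD.
apply: (@le_trans _ _ (expR x * expR (- x ^+ 2))).
  rewrite ler_wpM2r ?expR_ge0// (le_trans _ (expR_ge1Dx x))//.
  by rewrite lerDr.
rewrite -expRD ler_expR -subr_ge0.
by rewrite (_ : _ - _ = (x - 1) ^+ 2) ?sqr_ge0//; ring.
Unshelve. all: end_near. Qed.

(** Integration by parts with [x] as one factor and [x * gauss_fun x], whose antiderivative is
    [- gauss_fun x / 2], as the other. *)
Lemma integral_sqr_gauss_itv (R : realType) (a : R) : 0 < a ->
  (\int[@lebesgue_measure R]_(x in `[0%R, a]) (x ^+ 2 * gauss_fun x)%:E =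
   (- (a * gauss_fun a) / 2)%:E +
   2^-1%:E * \int[@lebesgue_measure R]_(x in `[0%R, a]) (gauss_fun x)%:E)%E.
Proof.
move=> a0.
have dG (x : R) : is_derive x 1 (fun x : R => - gauss_fun x / 2) (x * gauss_fun x).
  by rewrite /gauss_fun; apply: is_derive_eq; rewrite /GRing.scale/=; field.
have cG : continuous (fun x : R => - gauss_fun x / 2).
  by move=> x; apply/differentiable_continuous/derivable1_diffP; have [] := dG x.
have cg : continuous (fun x : R => x * gauss_fun x).
  by move=> x; apply: continuousM; [exact: cvg_id|exact: continuous_gauss_fun].
have LR (F : R -> R) : continuous F -> F x @[x --> 0^'+] --> F 0 /\
    F x @[x --> a^'-] --> F a.
  by move=> cF; split; [exact/cvg_at_right_filter/cF|exact/cvg_at_left_filter/cF].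
under eq_integral do rewrite expr2 -mulrA.
rewrite (@integration_by_parts _ id (fun x => - gauss_fun x / 2) (cst 1))//.
- congr (_ + _)%E; first by rewrite mul0r subr0 mulNr mulrN mulNr mulrA.
  under eq_integral do rewrite mul1r mulNr mulrC -mulNr EFinM.
  rewrite integralZl//=; last first.
    by apply: (integrableS _ _ (subsetT _)) => //; exact: integrableT_gauss.
  by rewrite EFinN mulNe oppeK.
- by move=> x; exact: cvg_cst.
- have [] := LR id; first by move=> x; exact: cvg_id.
  by move=> ? ?; split.
- by move=> x _; rewrite derive1_id.
- exact: continuous_subspaceT.
- by have [? ?] := LR _ cG; split => // x _; have [] := dG x.
- by move=> x _; rewrite derive1E derive_val.
Qed.

(** By evenness the half-line suffices. There the integral is the limit over [[0, n]], where the
    boundary term vanishes and half of the Gaussian mass [sqrt pi / 2] remains. *)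
Lemma integralT_sqr_gauss (R : realType) :
  (\int[@lebesgue_measure R]_x (x ^+ 2 * gauss_fun x)%:E =
   (Num.sqrt pi / 2 : R)%:E)%E.
Proof.
have cf : continuous (fun x : R => x ^+ 2 * gauss_fun x).
  by move=> x; apply: cvgM; [exact: exprn_continuous|exact: continuous_gauss_fun].
have f0 (x : R) : 0 <= x ^+ 2 * gauss_fun x.
  by rewrite mulr_ge0 ?sqr_ge0 ?gauss_fun_ge0.
rewrite ge0_symfun_integralT//; last first.
  by move=> x/=; rewrite /gauss_fun sqrrN.
rewrite (_ : [set x | _] = `[0, +oo[%classic); last first.
  by apply/seteqP; split => x/=; rewrite in_itv/= andbT.
have mf := continuous_measurable_fun cf.
suff -> : (\int[@lebesgue_measure R]_(x in `[0%R, +oo[) (x ^+ 2 * gauss_fun x)%:E =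
    (Num.sqrt pi / 4)%:E)%E by rewrite -EFinM; congr EFin; field.
have /cvg_lim := @ge0_cvgn_integral R lebesgue_measure _ f0 mf.
move=> <-//.
have := @ge0_cvgn_integral R lebesgue_measure _ gauss_fun_ge0 measurable_gauss_fun.
rewrite integral0y_gauss => cI.
suff h : ((- (n%:R * gauss_fun n%:R) / 2)%:E + 2^-1%:E *
    \int[@lebesgue_measure R]_(x in `[0%R, n%:R]) (gauss_fun x)%:E)%E
    @[n --> \oo] --> ((0 : R)%:E + 2^-1%:E * (Num.sqrt pi / 2)%:E)%E.
  apply/cvg_lim => //.
  rewrite (_ : _%:E = ((0 : R)%:E + 2^-1%:E * (Num.sqrt pi / 2)%:E)%E); last first.
    by rewrite add0e -EFinM; congr EFin; field.
  apply: cvg_trans h; apply: near_eq_cvg; near=> n.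
  by rewrite integral_sqr_gauss_itv// ltr0n; near: n; exact: nbhs_infty_gt.
apply: cvgeD => //; last exact: cvgeZl.
apply: cvg_EFin; first by near=> n.
have /cvg_pinftyP/(_ _ cvgr_idn) h := @cvg_id_gauss R.
rewrite -(mulr0 (- 2^-1)).
under eq_cvg do rewrite /= mulrC mulrN -mulNr.
by apply: cvgMr.
Unshelve. all: end_near. Qed.

(** Nonnegativity allows the substitution before integrability is known; the finite values it yields
    then prove integrability. *)
Lemma ge0_integralT_affine (R : realType) (G : R -> R) (k c : R) : 0 < k ->
  continuous G -> (forall x, 0 <= G x) ->
  (\int[@lebesgue_measure R]_x (G (k * (x - c)))%:E =
   k^-1%:E * \int[@lebesgue_measure R]_x (G x)%:E)%E.
Proof.
move=> k0 cG G0; pose F (x : R) := k * (x - c).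
have dF (x : R) : is_derive x 1 F k.
  by rewrite /F; apply: is_derive_eq; rewrite /GRing.scale/=; ring.
have F'E : F^`()%classic = cst k.
  by apply/funext => x; rewrite derive1E derive_val.
have cGF : continuous (fun x => G (F x)).
  move=> x; apply: (@continuous_comp _ _ _ F G); last exact: cG.
  by apply/differentiable_continuous/derivable1_diffP; have [] := dF x.
have mGF := continuous_measurable_fun cGF.
rewrite (@increasing_ge0_integration_by_substitutionT _ F G)//.
- transitivity (k^-1%:E * \int[@lebesgue_measure R]_x (k%:E * (G (F x))%:E))%E.
    rewrite ge0_integralZl//=.
    + rewrite muleA -EFinM mulVf ?gt_eqF// mul1e; exact: eq_integral.
    + exact/measurable_EFinP.
    + by move=> x _; rewrite lee_fin.
    + by rewrite lee_fin ltW.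
  congr (_ * _)%E; apply: eq_integral => x _; rewrite F'E -EFinM; congr EFin.
  exact: mulrC.
- by move=> x y xy; rewrite /F ltr_pM2l// ltrD2r.
- by rewrite F'E => ?; exact: cvg_cst.
- by rewrite F'E; exact: is_cvg_cst.
- by rewrite F'E; exact: is_cvg_cst.
- by under eq_cvg do rewrite /F mulrC; apply/gt0_cvgMlNy => //; exact: cvg_addrr_Ny.
- by under eq_cvg do rewrite /F mulrC; apply/gt0_cvgMly => //; exact: cvg_addrr.
Qed.

(** With [k ^+ 2 = s / 2] the exponent is [- (k (x - c))^2], so the integral combines the zeroth and
    second moments of [gauss_fun]. The second moment is half the zeroth, which offsets the 2 in
    [s (x - c)^2 = 2 (k (x - c))^2] and gives the plain sum [a + b]. *)
Lemma integral_gauss_quadratic (R : realType) (s c a b : R) : 0 < s ->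
  (\int[@lebesgue_measure R]_x
     ((a + b * (s * (x - c) ^+ 2)) * expR (- 2^-1 * (s * (x - c) ^+ 2)))%:E =
   ((2 * pi) `^ (2^-1) * s `^ (- 2^-1) * (a + b))%:E)%E.
Proof.
move=> s0; pose k := Num.sqrt (s / 2).
have k0 : 0 < k by rewrite sqrtr_gt0 divr_gt0.
have k2 : k ^+ 2 = s / 2 by rewrite sqr_sqrtr// ltW// divr_gt0.
have cg : continuous (@gauss_fun R) by exact: continuous_gauss_fun.
have cf : continuous (fun x : R => x ^+ 2 * gauss_fun x).
  by move=> x; apply: cvgM; [exact: exprn_continuous|exact: continuous_gauss_fun].
have g0 (x : R) : 0 <= gauss_fun x by exact: gauss_fun_ge0.
have f0 (x : R) : 0 <= x ^+ 2 * gauss_fun x by rewrite mulr_ge0 ?sqr_ge0.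
have Ig := @ge0_integralT_affine R _ k c k0 cg g0.
have If := @ge0_integralT_affine R _ k c k0 cf f0.
rewrite integralT_gauss -EFinM in Ig; rewrite integralT_sqr_gauss -EFinM in If.
have caff (G : R -> R) : continuous G -> continuous (fun x => G (k * (x - c))).
  move=> cG x; apply: (@continuous_comp _ _ _ (fun x => k * (x - c)) G); last exact: cG.
  by apply: cvgM; [exact: cvg_cst|apply: cvgB; [exact: cvg_id|exact: cvg_cst]].
(* The signs of [a] and [b] are arbitrary, so splitting the sum calls for integrability of both
   parts. *)
have int (G : R -> R) r : continuous G -> (forall x, 0 <= G x) ->
    (\int[@lebesgue_measure R]_x (G (k * (x - c)))%:E = r%:E)%E ->
    (@lebesgue_measure R).-integrable setT (fun x => (G (k * (x - c)))%:E).
  move=> cG G0 e; apply/integrableP; split.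
    have mG := continuous_measurable_fun (caff _ cG).
    by apply/measurable_EFinP; exact: mG.
  under eq_integral do rewrite gee0_abs ?lee_fin//.
  by rewrite e ltry.
have ig := int _ _ cg g0 Ig; have iF := int _ _ cf f0 If.
transitivity (\int[@lebesgue_measure R]_x (a%:E * (gauss_fun (k * (x - c)))%:E +
    (2 * b)%:E * ((k * (x - c)) ^+ 2 * gauss_fun (k * (x - c)))%:E))%E.
  apply: eq_integral => x _; rewrite -!EFinM -EFinD; congr EFin.
  rewrite /gauss_fun exprMn k2.
  rewrite (_ : - 2^-1 * _ = - (s / 2 * (x - c) ^+ 2)); last by field.
  by field.
rewrite integralD//=; [|exact: integrableZl|exact: integrableZl].
rewrite !integralZl// Ig If -!EFinM -EFinD; congr EFin.
rewrite powRN !powR12_sqrt ?mulr_ge0 ?pi_ge0 ?(ltW s0)//.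
rewrite /k !sqrtrM ?(ltW s0)// sqrtrV//.
by field; rewrite !gt_eqF ?sqrtr_gt0.
Qed.

Lemma quad_form_block_diag (R : realType) n (s u : R) (Q : 'M[R]_n) (z : 'cV[R]_n) :
  ((col_mx (u%:M : 'M[R]_1) z)^T *m block_mx s%:M 0 0 Q *m
     col_mx (u%:M : 'M[R]_1) z) 0 0 =
  s * u ^+ 2 + (z^T *m Q *m z) 0 0.
Proof.
rewrite tr_col_mx mul_row_block !mulmx0 addr0 add0r mul_row_col mxE.
by congr (_ + _); rewrite tr_scalar_mx -!scalar_mxM mxE eqxx mulr1n; ring.
Qed.

(* The shift [m] is needed for the induction: for a fixed first coordinate, the
   quadratic form in the others is centred at a point depending on it. *)
Lemma intRn_gauss_quadratic (R : realType) n (Q : 'M[R]_n) (m : 'cV[R]_n) (a b : R) :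
  posdef Q ->
  intRn (fun y => ((a + b * ((y - m)^T *m Q *m (y - m)) 0 0) *
                   expR (- 2^-1 * ((y - m)^T *m Q *m (y - m)) 0 0))%:E) =
  ((2 * pi) `^ (n%:R / 2) * (\det Q) `^ (- 2^-1) * (a + b * n%:R))%:E.
Proof.
elim: n Q m a b => [|n IH]; last rewrite -[n.+1]/(1 + n)%N => Q m a b Qp.
  move=> Q m a b _ /=; rewrite det_mx00 powR1 mul0r powRr0.
  by rewrite [(0 - m)^T]thinmx0 !mul0mx mxE !mulr0 expR0 !mulr1 mul1r addr0.
have [s [w [s0 Q'p dQ eQ]]] := posdef_schur Qp.
set Q' := drsubmx Q in Q'p dQ eQ.
set c := usubmx m 0 0; set m' := dsubmx m.
have em : m = col_mx c%:M m' by rewrite -mx11_scalar vsubmxK.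
have quad x y : (((col_mx (x%:M : 'M[R]_1) y) - m)^T *m Q *m
      (col_mx (x%:M : 'M[R]_1) y - m)) 0 0 = s * (x - c) ^+ 2 +
    ((y - (m' - (x - c) *: w))^T *m Q' *m (y - (m' - (x - c) *: w))) 0 0.
  rewrite -quad_form_block_diag eQ; set L := block_mx 1%:M 0 w 1%:M.
  rewrite (_ : col_mx (x - c)%:M _ = L *m (col_mx x%:M y - m)).
    by rewrite trmx_mul !mulmxA.
  rewrite em opp_col_mx add_col_mx mul_block_col !mul1mx mul0mx addr0.
  by rewrite -(raddfB (@scalar_mx R 1)) mul_mx_scalar opprB addrCA.
pose K := (2 * pi) `^ (n%:R / 2) * (\det Q') `^ (- 2^-1) : R.
transitivity (\int[@lebesgue_measure R]_x ((K * (a + b * n%:R) +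
    (K * b) * (s * (x - c) ^+ 2)) * expR (- 2^-1 * (s * (x - c) ^+ 2)))%:E)%E.
  apply: eq_integral => x _.
  pose e := expR (- 2^-1 * (s * (x - c) ^+ 2)).
  (* The terms in [x] alone go into the coefficients: the induction hypothesis is applied with
     [e * (a + b * (s * (x - c) ^+ 2))] and [e * b] in place of [a] and [b]. *)
  transitivity (K * (e * (a + b * (s * (x - c) ^+ 2)) + (e * b) * n%:R))%:E.
    rewrite -(IH _ (m' - (x - c) *: w))//; congr intRn; apply/funext => y.
    by cbv beta; rewrite quad [- 2^-1 * (_ + _)]mulrDr expRD -/e; congr EFin; ring.
  by rewrite -/e; congr EFin; ring.
(* The outer integral adds one more [K * b], turning [b * n] into [b * (1 + n)]. *)
rewrite integral_gauss_quadratic//; congr EFin.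
rewrite dQ (@powRM _ s) ?(ltW s0) ?(ltW (posdef_det_gt0 Q'p))//.
rewrite (_ : (1 + n)%:R / 2 = 2^-1 + n%:R / 2); last by rewrite natrD; field.
rewrite powRD; last by rewrite mulf_neq0 ?implybT ?gt_eqF ?pi_gt0.
by rewrite /K natrD; ring.
Qed.

(** The logarithm of the density is [ln c - q / 2], with [q] the quadratic form of [invmx S]. So the
    integrand has the shape [(a + b q) exp (- q / 2)] with [a = c ln c] and [b = - c / 2], and the
    entropy is [n / 2 - ln c]. *)
Lemma entropy_gauss (R : realType) n (S : 'M[R]_n) : posdef S ->
  entropy (gauss_density S) =
  (n%:R / 2 * (1 + ln (2 * pi)) + 2^-1 * ln (\det S))%:E.
Proof.
move=> Sp; have Pp := posdef_inv Sp; have dS := posdef_det_gt0 Sp.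
have pi2 : 0 < 2 * pi :> R by rewrite mulr_gt0// pi_gt0.
rewrite /entropy /gauss_density.
set c := _ `^ _ * _ `^ _.
have c0 : 0 < c by rewrite mulr_gt0// powR_gt0.
have lc : ln c = - (n%:R / 2 * ln (2 * pi) + 2^-1 * ln (\det S)).
  by rewrite /c [LHS]lnM ?posrE ?powR_gt0// !ln_powR; ring.
transitivity (- intRn (fun y => ((c * ln c + (- c / 2) *
   ((y - 0)^T *m invmx S *m (y - 0)) 0 0) *
   expR (- 2^-1 * ((y - 0)^T *m invmx S *m (y - 0)) 0 0))%:E))%E.
  congr (- intRn _)%E; apply/funext => y; rewrite subr0; congr EFin.
  by rewrite lnM ?posrE ?expR_gt0// expRK; ring.
rewrite intRn_gauss_quadratic// -EFinN; congr EFin.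
(* The Gaussian integral is the reciprocal of the normalising constant. *)
rewrite (_ : _ `^ _ * _ `^ _ = c^-1).
  by rewrite -[n%:R / 2 * _]mulrC lc; field; rewrite gt_eqF.
rewrite /c det_inv invfM -!powRN opprK; congr (_ * _).
by rewrite -(powR_inv1 (ltW dS)) -powRrM mulN1r opprK.
Qed.

(** * Matrix powers and simultaneous diagonalisation *)

Lemma prod_powR (R : realType) (I : Type) (r : seq I) (F : I -> R) (t : R) :
  (forall i, 0 <= F i) -> \prod_(i <- r) (F i `^ t) = (\prod_(i <- r) F i) `^ t.
Proof.
move=> F0; elim: r => [|i r IH]; first by rewrite !big_nil powR1.
by rewrite !big_cons IH powRM ?prodr_ge0.
Qed.

Lemma ln_prod (R : realType) (I : Type) (r : seq I) (F : I -> R) :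
  (forall i, 0 < F i) -> ln (\prod_(i <- r) F i) = \sum_(i <- r) ln (F i).
Proof.
move=> F0; elim: r => [|i r IH]; first by rewrite !big_nil ln1.
by rewrite !big_cons lnM ?posrE ?prodr_gt0// IH.
Qed.

(** The spectral theorem makes the set behind [xget] nonempty, so the default 0 is never taken.
    Whichever power was chosen comes with a decomposition, from which later facts are read off. *)
Lemma mxpowRP (R : realType) n (A : 'M[R]_n) (t : R) : posdef A ->
  exists (U : 'M[R]_n) (d : 'rV[R]_n), [/\ orthogonal_mx U,
    forall i, 0 < d 0 i, A = U *m diag_mx d *m U^T &
    mxpowR A t = U *m diag_mx (map_mx (fun a => a `^ t) d) *m U^T].
Proof.
move=> /posdef_spectral[U [d [UU d0 eA]]].
rewrite /mxpowR; case: xgetP => [P _ //|/(_ (U *m diag_mx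
  (map_mx (fun a => a `^ t) d) *m U^T))[]].
by exists U, d.
Qed.

Lemma posdef_mxpowR (R : realType) n (A : 'M[R]_n) (t : R) :
  posdef A -> posdef (mxpowR A t).
Proof.
move=> /(mxpowRP t)[U [d [UU d0 _ ->]]]; apply: posdef_orthogonal_diag => // i.
by rewrite mxE powR_gt0.
Qed.

Lemma det_mxpowR (R : realType) n (A : 'M[R]_n) (t : R) :
  posdef A -> \det (mxpowR A t) = (\det A) `^ t.
Proof.
move=> /(mxpowRP t)[U [d [UU d0 -> ->]]].
rewrite !det_orthogonal_conj// !det_diag -prod_powR => [|i]; last exact: ltW.
by apply: eq_bigr => i _; rewrite mxE.
Qed.

Lemma posdef_congr_sym (R : realType) n (A M : 'M[R]_n) :
  posdef M -> posdef A -> posdef (M *m A *m M).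
Proof.
move=> Mp; rewrite -{1}(posdef_sym Mp).
by apply: posdef_congr; exact: posdef_unit.
Qed.

Lemma posdef_mxgeo (R : realType) n (A B : 'M[R]_n) (t : R) :
  posdef A -> posdef B -> posdef (mxgeo A B t).
Proof.
move=> Ap Bp; apply: posdef_congr_sym; first exact: posdef_mxpowR.
by apply/posdef_mxpowR/posdef_congr_sym => //; exact: posdef_mxpowR.
Qed.

(** The outer factors contribute [det A] to the power [1/2] twice, the inner ones to the power
    [- t / 2] twice: in total [1 - t]. *)
Lemma ln_det_mxgeo (R : realType) n (A B : 'M[R]_n) (t : R) :
  posdef A -> posdef B ->
  ln (\det (mxgeo A B t)) = (1 - t) * ln (\det A) + t * ln (\det B).
Proof.
move=> Ap Bp; have dA := posdef_det_gt0 Ap; have dB := posdef_det_gt0 Bp.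
have Cp : posdef (mxpowR A (- 2^-1) *m B *m mxpowR A (- 2^-1)).
  by apply: posdef_congr_sym => //; exact: posdef_mxpowR.
rewrite /mxgeo !det_mulmx det_mxpowR// det_mxpowR// !det_mulmx det_mxpowR//.
rewrite !lnM ?posrE ?mulr_gt0 ?powR_gt0 ?mulr_gt0 ?powR_gt0//.
rewrite !ln_powR !lnM ?posrE ?mulr_gt0 ?powR_gt0// !ln_powR.
by field.
Qed.

(** Factor [A = S S^T] and diagonalise [S^-1 B S^-T] by an orthogonal [V]. Since [V V^T = 1],
    replacing [S] by [T = S V] keeps the factorisation of [A] and makes [B] diagonal. *)
Lemma posdef_simultaneous_diag (R : realType) n (A B : 'M[R]_n) :
  posdef A -> posdef B ->
  exists (T : 'M[R]_n) (d : 'rV[R]_n), [/\ T \in unitmx, forall i, 0 < d 0 i,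
    A = T *m T^T & B = T *m diag_mx d *m T^T].
Proof.
move=> Ap Bp; have [U [a [UU a0 eA]]] := posdef_spectral Ap.
pose D := diag_mx (map_mx (@Num.sqrt R) a); pose S := U *m D.
have eS : A = S *m S^T.
  rewrite /S trmx_mul tr_diag_mx mulmxA -(mulmxA U) eA; congr (_ *m _ *m _).
  rewrite mulmx_diag; congr diag_mx; apply/rowP => i; rewrite !mxE -expr2.
  by rewrite sqr_sqrtr// ltW.
have uS : S \in unitmx.
  by have := posdef_unit Ap; rewrite eS unitmx_mul => /andP[].
have Cp : posdef (invmx S *m B *m (invmx S)^T).
  rewrite -{1}[invmx S]trmxK; apply: posdef_congr => //.
  by rewrite unitmx_tr unitmx_inv.
have [V [d [VV d0 eC]]] := posdef_spectral Cp.
exists (S *m V), d; split=> //.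
- by rewrite unitmx_mul uS orthogonal_mx_unit.
- by rewrite trmx_mul mulmxA -(mulmxA S) (mulmx1C VV) mulmx1.
- rewrite trmx_mul -(mulmxA S) -(mulmxA S) (mulmxA _ V^T) -eC.
  by rewrite !mulmxA mulmxV// mul1mx -mulmxA -trmx_mul mulmxV// trmx1 mulmx1.
Qed.

(** * The trace along the segment and its integral *)

Lemma trace_inv_segment (R : realType) n (T : 'M[R]_n) (d : 'rV[R]_n) (l : R) :
  T \in unitmx -> (forall i, 0 < 1 + l * (d 0 i - 1)) ->
  \tr (invmx ((1 - l) *: (T *m T^T) + l *: (T *m diag_mx d *m T^T)) *m
       (T *m diag_mx d *m T^T - T *m T^T)) =
  \sum_i (d 0 i - 1) / (1 + l * (d 0 i - 1)).
Proof.
move=> uT e0.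
pose E := diag_mx (\row_i (1 + l * (d 0 i - 1))).
pose G := diag_mx (\row_i ((d 0 i - 1) / (1 + l * (d 0 i - 1)))).
have uE : E \in unitmx.
  rewrite unitmxE det_diag unitfE; apply/prodf_neq0 => i _.
  by rewrite mxE gt_eqF.
have -> : (1 - l) *: (T *m T^T) + l *: (T *m diag_mx d *m T^T) = T *m E *m T^T.
  have -> : E = (1 - l)%:M + l *: diag_mx d.
    apply/matrixP => i j; rewrite !mxE.
    by case: eqVneq => _; rewrite ?mulr1n ?mulr0n; ring.
  by rewrite mulmxDr mulmxDl mul_mx_scalar -!scalemxAl -scalemxAr -scalemxAl.
(* The difference is factored as the segment matrix times a conjugate of the diagonal [G]: the
   inverse cancels the first factor, and cyclicity of the trace removes the conjugation. *)
have -> : T *m diag_mx d *m T^T - T *m T^T =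
    T *m E *m T^T *m (invmx T^T *m G *m T^T).
  have <- : T *m (E *m G) *m T^T = T *m E *m T^T *m (invmx T^T *m G *m T^T).
    by rewrite !mulmxA mulmxK ?unitmx_tr.
  have -> : E *m G = diag_mx d - 1%:M.
    rewrite mulmx_diag; apply/matrixP => i j; rewrite !mxE.
    case: eqVneq => [->|_]; rewrite ?mulr1n ?mulr0n ?subr0//.
    by rewrite mulrCA mulfV ?mulr1// gt_eqF.
  by rewrite mulmxBr mulmxBl mulmx1.
rewrite mulKmx ?unitmx_mul ?uT ?uE ?unitmx_tr//.
rewrite mxtrace_mulC mulmxA mulmxV ?unitmx_tr// mul1mx.
by rewrite mxtrace_diag; apply: eq_bigr => i _; rewrite mxE.
Qed.

(** The integrand is the derivative of [F], and [F 0 = 0] because each logarithm is taken at 1. *)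
Lemma integral_sum_log_derivative (R : realType) n (d : 'rV[R]_n) :
  (forall i, 0 < d 0 i) ->
  (\int[@lebesgue_measure R]_(l in `[0%R, 1%R])
     (\sum_i (d 0 i - 1) / (1 + l * (d 0 i - 1)))%:E =
   (\sum_i ln (d 0 i))%:E)%E.
Proof.
move=> d0.
(* The value is the convex combination [(1 - l) + l * d 0 i] of positive numbers. *)
have e0 (l : R) i : 0 <= l <= 1 -> 0 < 1 + l * (d 0 i - 1).
  move=> /andP[l0 l1]; have := d0 i; nra.
pose f (l : R) := \sum_i (d 0 i - 1) / (1 + l * (d 0 i - 1)).
pose F (l : R) := \sum_i ln (1 + l * (d 0 i - 1)).
have dF (l : R) : 0 <= l <= 1 -> is_derive l 1 F (f l).
  move=> l01.
  have -> : F = \sum_i (fun x : R => ln (1 + x * (d 0 i - 1))).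
    by apply/funext => x; rewrite fct_sumE.
  apply: is_derive_sum => i; rewrite mulrC.
  have dln : is_derive (1 + l * (d 0 i - 1)) 1 (@ln R) (1 + l * (d 0 i - 1))^-1.
    exact/is_derive1_ln/e0.
  have daff : is_derive l 1 (fun x : R => 1 + x * (d 0 i - 1)) (d 0 i - 1).
    by apply: is_derive_eq; rewrite /GRing.scale/=; ring.
  exact: (@is_derive1_comp R (@ln R) (fun x : R => 1 + x * (d 0 i - 1)) l).
have cF (x : R) : 0 <= x <= 1 -> {for x, continuous F}.
  by move=> /dF[? _]; exact/differentiable_continuous/derivable1_diffP.
rewrite (@continuous_FTC2 _ f F 0 1 ltr01).
- rewrite -EFinB; congr EFin; rewrite /F -sumrB; apply: eq_bigr => i _.
  by rewrite mul0r addr0 ln1 subr0 mul1r addrC subrK.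
- apply: continuous_in_subspaceT => l; rewrite inE/= in_itv/= => l01.
  apply: cvg_big => [|i _]; first exact: add_continuous.
  apply: cvgM; first exact: cvg_cst.
  apply: cvgV; first by rewrite gt_eqF// e0.
  apply: cvgD; first exact: cvg_cst.
  by apply: cvgM; [exact: cvg_id|exact: cvg_cst].
- split.
  + move=> l; rewrite in_itv/= => /andP[/ltW l0 /ltW l1].
    by have [] := dF l; rewrite ?l0.
  + by apply: cvg_at_right_filter; apply: cF; rewrite lexx ler01.
  + by apply: cvg_at_left_filter; apply: cF; rewrite lexx ler01.
- move=> l; rewrite in_itv/= => /andP[/ltW l0 /ltW l1].
  have ? : is_derive l 1 F (f l) by apply: dF; rewrite l0.
  by rewrite derive1E derive_val.
Qed.

Unset Implicit Arguments.

Theorem theorem6p5 (R : realType) (n : nat) (E : rel 'I_n)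
  (E_loops : forall i, E i i) (E_sym : symmetric E)
  (E_compl : @completable R n E)
  (SigmaG : 'M[R]_n) (HSigmaG : partial_posdef E SigmaG)
  (Sigma0 Sigma1 : 'M[R]_n)
  (H0 : pd_completions E SigmaG Sigma0) (H1 : pd_completions E SigmaG Sigma1) :
  (entropy (gauss_density Sigma1) - entropy (gauss_density Sigma0) =
     (2^-1)%:E *
     \int[@lebesgue_measure R]_(l in `[0%R, 1%R])
        (\tr (invmx ((1 - l) *: Sigma0 + l *: Sigma1) *m (Sigma1 - Sigma0)))%:E)%E
  /\
  (forall t : R, 0 <= t <= 1 ->
     entropy (gauss_density (mxgeo Sigma0 Sigma1 t)) =
     ((1 - t)%:E * entropy (gauss_density Sigma0) +
      t%:E * entropy (gauss_density Sigma1))%E).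
Proof.
move: H0 H1 => [_ p0] [_ p1]; split; last first.
  move=> t _; rewrite !entropy_gauss//; last exact: posdef_mxgeo.
  (* The dimensional constant of the entropy survives because the weights [1 - t] and [t] sum to
     1. *)
  by rewrite ln_det_mxgeo// -!EFinM -EFinD; congr EFin; ring.
rewrite !entropy_gauss//.
have [T [d [uT d0 e0 e1]]] := posdef_simultaneous_diag p0 p1.
rewrite (_ : (\int[_]_(l in _) _)%E = (\sum_i ln (d 0 i))%:E); last first.
  rewrite -integral_sum_log_derivative//; apply: eq_integral => l.
  rewrite inE/= in_itv/= => /andP[l0 l1]; rewrite e0 e1 trace_inv_segment// => i.
  by have := d0 i; nra.
rewrite -EFinB -EFinM; congr EFin.
(* Both determinants carry the factor [(det T)^2], so the entropies differ by half the sum of the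
   [ln (d 0 i)]. *)
have -> : \det Sigma1 = \det Sigma0 * \prod_i d 0 i.
  by rewrite e0 e1 !det_mulmx det_diag mulrAC.
have dd : 0 < \prod_i d 0 i by apply: prodr_gt0.
rewrite [ln (\det Sigma0 * _)]lnM ?posrE ?posdef_det_gt0//.
by rewrite ln_prod//; ring.
Qed.
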